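(* As an identity of formal power series in $x,y$, \[T_3(x,y)=\frac{P(x,y)F_3(y)+Q(x,y)G_3(xy)+R(x,y)}{x^3y^3-(1-x)^3},\] where \[P(x,y)=xy\left(x^2y^2-(1-x)^2\right),\] \[Q(x,y)=(x-1)x^2y(xy+x-1),\] \[R(x,y)=(x-1)xy\left((x-1)^2-x^2y^2\right).\]
   Context: A permutation $w\in S_n$ has a $3$-descent at $i$ (with $1\le i\le n-2$) if $w(i)>w(i+1)>w(i+2)$. Let $f_3(n)$ be the number of $w\in S_n$ with no $3$-descent; for $1\le m\le n$ let $f_3(m,n)$ be the number of $w\in S_n$ with no $3$-descent and $w(1)=m$; and let $g_3(n)$ be the number of $w\in S_n$ with no $3$-descent and no initial descent (i.e. not ($n\ge2$ and $w(1)>w(2)$)). Define the ordinary generating functions \[T_3(x,y)=\sum_{1\le m\le n}f_3(m,n)x^my^n,\qquad F_3(y)=\sum_{n\ge1}f_3(n)y^n,\qquad G_3(z)=\sum_{n\ge1}g_3(n)z^n.\] *)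

(* Defs.v *)
From HB Require Import structures.
From mathcomp Require Import all_boot all_order all_algebra all_fingroup.
From mathcomp Require Import boolp.

Set Implicit Arguments.
Unset Strict Implicit.
Unset Printing Implicit Defensive.

Import GRing.Theory.

Local Open Scope ring_scope.

(* R[[x, y]] is encoded as (R[[x]])[[y]], that is {fps {fps R}}.              *)

Record fps (R : Type) : Type := FPS { coeffps : nat -> R }.

Definition fps_of (R : Type) (f : nat -> R) : fps R := FPS f.

Notation "{ 'fps' R }" := (fps R) (at level 0, format "{ 'fps'  R }").
Notation "f .[^ n ]" := (coeffps f n) (at level 1, format "f .[^ n ]").
Notation "\fps_ n E" := (fps_of (fun n : nat => E))
  (at level 36, n name, E at level 36, format "\fps_ n  E").

Lemma fpsP (R : Type) (f g : {fps R}) :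
  (forall n, f.[^ n] = g.[^ n]) <-> f = g.
Proof.
split=> [|-> //]; case: f => f; case: g => g /= fg.
by congr FPS; apply: funext.
Qed.

HB.instance Definition _ (R : Type) := gen_eqMixin {fps R}.
HB.instance Definition _ (R : Type) := gen_choiceMixin {fps R}.

Section FpsZmod.
Variable R : zmodType.
Implicit Types f g h : {fps R}.

Definition fps_zero : {fps R} := \fps_n 0.
Definition fps_opp f : {fps R} := \fps_n (- f.[^ n]).
Definition fps_add f g : {fps R} := \fps_n (f.[^ n] + g.[^ n]).

Lemma fps_addA : associative fps_add.
Proof. by move=> f g h; apply/fpsP => n /=; rewrite addrA. Qed.
Lemma fps_addC : commutative fps_add.
Proof. by move=> f g; apply/fpsP => n /=; rewrite addrC. Qed.
Lemma fps_add0 : left_id fps_zero fps_add.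
Proof. by move=> f; apply/fpsP => n /=; rewrite add0r. Qed.
Lemma fps_addN : left_inverse fps_zero fps_opp fps_add.
Proof. by move=> f; apply/fpsP => n /=; rewrite addNr. Qed.

HB.instance Definition _ :=
  GRing.isZmodule.Build {fps R} fps_addA fps_addC fps_add0 fps_addN.

Lemma coeffps0 n : (0 : {fps R}).[^ n] = 0. Proof. by []. Qed.
Lemma coeffpsD f g n : (f + g).[^ n] = f.[^ n] + g.[^ n]. Proof. by []. Qed.
Lemma coeffpsN f n : (- f).[^ n] = - f.[^ n]. Proof. by []. Qed.
Lemma coeffpsB f g n : (f - g).[^ n] = f.[^ n] - g.[^ n]. Proof. by []. Qed.
End FpsZmod.

Section FpsRing.
Variable R : comNzRingType.
Implicit Types f g h : {fps R}.

Definition fpsC (c : R) : {fps R} := \fps_n (if n == 0%N then c else 0).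
Definition fpsX : {fps R} := \fps_n (n == 1%N)%:R.

Definition fps_mul f g : {fps R} :=
  \fps_n (\sum_(i < n.+1) f.[^ i] * g.[^ (n - i)]).

Definition fps_trunc n f : {poly R} := \poly_(i < n.+1) f.[^ i].

Lemma coef_fps_trunc n f k : (k <= n)%N -> (fps_trunc n f)`_k = f.[^ k].
Proof. by move=> le_kn; rewrite coef_poly ltnS le_kn. Qed.

Lemma fps_mul_trunc n f g k : (k <= n)%N ->
  (fps_mul f g).[^ k] = (fps_trunc n f * fps_trunc n g)`_k.
Proof.
move=> le_kn; rewrite coefM /=; apply: eq_bigr => i _.
by rewrite !coef_fps_trunc // (leq_trans _ le_kn) ?leq_subr // -ltnS.
Qed.

Lemma fps_mulC : commutative fps_mul.
Proof.
by move=> f g; apply/fpsP => n; rewrite !(@fps_mul_trunc n) // mulrC.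
Qed.

Lemma fps_mulA : associative fps_mul.
Proof.
move=> f g h; apply/fpsP => n.
transitivity ((fps_trunc n f * (fps_trunc n g * fps_trunc n h))`_n).
  rewrite coefM /=; apply: eq_bigr => i _.
  have lein : (i <= n)%N by rewrite -ltnS.
  by rewrite coef_fps_trunc // -fps_mul_trunc // leq_subr.
rewrite mulrA coefM /=; apply: eq_bigr => i _.
have lein : (i <= n)%N by rewrite -ltnS.
by rewrite coef_fps_trunc ?leq_subr // -fps_mul_trunc.
Qed.

Lemma fps_mul1 : left_id (fpsC 1) fps_mul.
Proof.
move=> f; apply/fpsP => n /=.
rewrite big_ord_recl /= mul1r subn0 big1 ?addr0 // => i _.
by rewrite mul0r.
Qed.

Lemma fps_mulDl : left_distributive fps_mul (@fps_add R).
Proof.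
move=> f g h; apply/fpsP => n /=; rewrite -big_split /=.
by apply: eq_bigr => i _; rewrite mulrDl.
Qed.

Lemma fps_oner_neq0 : fpsC 1 != 0 :> {fps R}.
Proof.
apply/eqP => /fpsP/(_ 0%N) /= /eqP.
by rewrite oner_eq0.
Qed.

HB.instance Definition _ := GRing.Zmodule_isComNzRing.Build {fps R}
  fps_mulA fps_mulC fps_mul1 fps_mulDl fps_oner_neq0.

Lemma coeffps1 n : (1 : {fps R}).[^ n] = (n == 0%N)%:R.
Proof. by case: n. Qed.
Lemma coeffpsM f g n :
  (f * g).[^ n] = \sum_(i < n.+1) f.[^ i] * g.[^ (n - i)].
Proof. by []. Qed.
Lemma coeffps0M f g : (f * g).[^ 0] = f.[^ 0] * g.[^ 0].
Proof. by rewrite coeffpsM big_ord_recl big_ord0 addr0. Qed.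
Lemma coeffps0X f k : (f ^+ k).[^ 0] = f.[^ 0] ^+ k.
Proof.
elim: k => [|k IHk]; first by rewrite !expr0 coeffps1.
by rewrite !exprS coeffps0M IHk.
Qed.
Lemma coeffpsC c n : (fpsC c).[^ n] = if n == 0%N then c else 0.
Proof. by []. Qed.
Lemma coeffpsX n : fpsX.[^ n] = (n == 1%N)%:R.
Proof. by []. Qed.
End FpsRing.

Arguments fpsX {R}.

Section FpsUnitRing.
Variable R : comUnitRingType.
Implicit Types f g h : {fps R}.

Definition fps_unit : pred {fps R} := [pred f : {fps R} | f.[^ 0] \is a GRing.unit].

(* The first n + 1 coefficients of 1 / f, from v_0 = 1 / f_0 and              *)
(* v_(n+1) = - (1 / f_0) * sum_(i <= n) v_i * f_(n + 1 - i).                  *)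
Fixpoint fps_invseq f (n : nat) : seq R :=
  if n is n'.+1 then
    let s := fps_invseq f n' in
    rcons s (- (f.[^ 0])^-1 * \sum_(i < n) s`_i * f.[^ (n - i)])
  else [:: (f.[^ 0])^-1].

Definition fps_inv f : {fps R} :=
  if fps_unit f then \fps_n (fps_invseq f n)`_n else f.

Lemma size_fps_invseq f n : size (fps_invseq f n) = n.+1.
Proof. by elim: n => //= n IHn; rewrite size_rcons IHn. Qed.

Lemma nth_fps_invseq f n k : (k <= n)%N ->
  (fps_invseq f n)`_k = (fps_invseq f k)`_k.
Proof.
elim: n => [|n IHn]; first by rewrite leqn0 => /eqP ->.
rewrite leq_eqVlt => /predU1P[-> //|lt_kn].
by rewrite [fps_invseq f n.+1]/= nth_rcons size_fps_invseq lt_kn IHn.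
Qed.

Lemma fps_mulVr : {in fps_unit, left_inverse 1 fps_inv *%R}.
Proof.
move=> f uf; have uf0 : f.[^ 0] \is a GRing.unit := uf.
rewrite /fps_inv ifT //; apply/fpsP => -[|n].
  by rewrite coeffps0M coeffps1 /= mulVr.
rewrite coeffpsM coeffps1 big_ord_recr /= subnn.
rewrite nth_rcons size_fps_invseq ltnn eqxx mulrC mulrA mulrN divrr // mulN1r.
apply/eqP; rewrite subr_eq0; apply/eqP.
by apply: eq_bigr => i _; rewrite (@nth_fps_invseq f n i) // -ltnS.
Qed.

Lemma fps_unitP f g : g * f = 1 -> fps_unit f.
Proof.
move=> /fpsP/(_ 0%N); rewrite coeffps0M coeffps1 /= => gf1.
by apply/unitrPr; exists (g.[^ 0]); rewrite mulrC.
Qed.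

Lemma fps_inv_out : {in [predC fps_unit], fps_inv =1 id}.
Proof. by move=> f nuf; rewrite /fps_inv ifN. Qed.

HB.instance Definition _ := GRing.ComNzRing_hasMulInverse.Build {fps R}
  fps_mulVr fps_unitP fps_inv_out.

Lemma fps_unitE f : (f \is a GRing.unit) = (f.[^ 0] \is a GRing.unit).
Proof. by []. Qed.
End FpsUnitRing.

(* The substitution f(s), for f in R[[t]] and s in (R[[x]])[[y]].  It is only *)
(* meaningful when s has zero constant coefficient in y; then s ^+ k has no   *)
(* term in y^n for k > n, so that the sum below is the whole coefficient.     *)
Definition fps_subst (R : comNzRingType) (f : {fps R}) (s : {fps {fps R}}) :
    {fps {fps R}} :=
  \fps_n (\sum_(k < n.+1) fpsC (f.[^ k]) * (s ^+ k).[^ n]).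

Lemma coeffpsCM (R : comNzRingType) (c : R) (f : {fps R}) (n : nat) :
  (fpsC c * f).[^ n] = c * f.[^ n].
Proof.
rewrite coeffpsM big_ord_recl /= subn0 big1 ?addr0 // => i _.
by rewrite mul0r.
Qed.

Lemma coeffpsXn (R : comNzRingType) (k n : nat) :
  ((fpsX : {fps R}) ^+ k).[^ n] = (n == k)%:R.
Proof.
elim: k n => [|k IHk] n; first by rewrite expr0 coeffps1.
rewrite exprS coeffpsM; case: n => [|n].
  by rewrite big_ord_recl big_ord0 coeffpsX mul0r addr0.
rewrite 2!big_ord_recl big1 => [|i _]; last by rewrite coeffpsX mul0r.
by rewrite !coeffpsX mul0r mul1r add0r addr0 IHk subSS subn0 eqSS.
Qed.

Lemma coeff_fps_substCX (R : comNzRingType) (f c : {fps R}) (n : nat) :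
  (fps_subst f (fpsC c * fpsX)).[^ n] = fpsC (f.[^ n]) * c ^+ n.
Proof.
have CXn k : (fpsC c * fpsX) ^+ k = fpsC (c ^+ k) * fpsX ^+ k.
  rewrite exprMn; congr (_ * _); elim: k => [|k IHk] //.
  rewrite !exprS IHk; apply/fpsP => m; rewrite coeffpsCM !coeffpsC.
  by case: ifP => _ //; rewrite mulr0.
rewrite /= big_ord_recr /= big1 => [|i _].
  by rewrite add0r CXn coeffpsCM coeffpsXn eqxx mulr1.
by rewrite CXn coeffpsCM coeffpsXn gtn_eqF // !mulr0.
Qed.

(* The two variables of Z[[x, y]]; the coefficient of x^m y^n in f is         *)
(* f.[^ n].[^ m].                                                             *)
Definition varx : {fps {fps int}} := fpsC fpsX.
Definition vary : {fps {fps int}} := fpsX.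

Local Open Scope nat_scope.

(* The value w(i) with positions and values both numbered from 1 to n.        *)
Definition wval (n : nat) (w : 'S_n) (i : nat) : nat :=
  if insub i.-1 is Some j then (w (j : 'I_n)).+1 else 0.

Definition descent3_at (n : nat) (w : 'S_n) (i : nat) : bool :=
  [&& 1 <= i, i + 2 <= n, wval w i.+1 < wval w i & wval w i.+2 < wval w i.+1].

Definition no_descent3 (n : nat) (w : 'S_n) : bool :=
  [forall i : 'I_n.+1, ~~ descent3_at w i].

Definition initial_descent (n : nat) (w : 'S_n) : bool :=
  (2 <= n) && (wval w 2 < wval w 1).

Definition f3 (n : nat) : nat := #|[set w : 'S_n | no_descent3 w]|.

Definition f3_first (m n : nat) : nat :=
  #|[set w : 'S_n | no_descent3 w & wval w 1 == m]|.

Definition g3 (n : nat) : nat :=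
  #|[set w : 'S_n | no_descent3 w & ~~ initial_descent w]|.

Local Open Scope ring_scope.

Definition T3 : {fps {fps int}} :=
  \fps_n (\fps_m (if (1 <= m <= n)%N then (f3_first m n)%:Z else 0)).

Definition F3 : {fps int} := \fps_n (if (1 <= n)%N then (f3 n)%:Z else 0).

Definition G3 : {fps int} := \fps_n (if (1 <= n)%N then (g3 n)%:Z else 0).

Lemma T3_denominator_unit :
  varx ^+ 3 * vary ^+ 3 - (1 - varx) ^+ 3 \is a GRing.unit.
Proof.
by rewrite !fps_unitE !(coeffps0X, coeffpsB, coeffps0M).
Qed.

Lemma coeff_fps_subst_vary (f : {fps int}) (n m : nat) :
  (fps_subst f vary).[^ n].[^ m] = if m == 0%N then f.[^ n] else 0.
Proof.
have -> : vary = fpsC 1 * fpsX by rewrite mul1r.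
by rewrite coeff_fps_substCX expr1n mulr1.
Qed.

Lemma coeff_fps_subst_varxy (f : {fps int}) (n m : nat) :
  (fps_subst f (varx * vary)).[^ n].[^ m] = if m == n then f.[^ n] else 0.
Proof.
rewrite coeff_fps_substCX coeffpsCM coeffpsXn.
by case: eqP => _; rewrite ?mulr1 ?mulr0.
Qed.

(* Main.v *)
Require Import Defs.
From mathcomp Require Import all_boot all_order all_algebra all_fingroup.
From mathcomp Require Import ring zify.
Import GRing.Theory.
Local Open Scope ring_scope.

(** Deleting the first letter of a permutation [w] of size [n.+1] and
    standardizing the rest leaves a permutation [s] of size [n]; the pair
    formed by [w(1)] and [s] determines [w].  The two initial comparisons of
    [w] are read off this pair: [w] has an initial descent exactly when
    [s(1) < w(1)], and [w] has a 3-descent exactly when [s] has one or both [w]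
    and [s] have an initial descent.  Let [A] and [D] be the parts of [T] that
    come from the permutations without and with an initial descent.  For a
    fixed [s] without 3-descent the admissible values of [w(1)] form an interval: [1 .. s(1)]
    for [A], and [s(1)+1 .. n+1] for [D], where [s] itself must have no
    initial descent.  Summing the geometric progression over that interval
    gives
      [(1 - x) A = (1 - x) x y + x y (F(y) - T)],
      [(1 - x) D = x y A - x^2 y G(x y)],
    since the end of each interval given by [s(1)] contributes the series of
    [s] by first letter, while the other end does not depend on [s] and so only
    counts: the lower end [1] of the first interval produces [F(y)], and the
    upper end [n+1] of the second, whose power of [x] follows the size,
    produces [G(x y)].  The term [(1 - x) x y] accounts for the permutation of
    size one.  At a fixed size these equations are [first_letter_gf_ascent] and
    [first_letter_gf_descent].

    Eliminating [A] and [D = T - A] yields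
      [(x^2 y^2 + x y (1 - x) + (1 - x)^2) T
         = (x y + 1 - x) x y (F(y) + 1 - x) - (1 - x) x^2 y G(x y)],
    and multiplication by [x y - (1 - x)] turns the factor of [T] into the
    difference of cubes of the statement. *)

(** * Permutations and their first letter *)

Lemma wval_ord (n : nat) (w : 'S_n) (j : 'I_n) : wval w j.+1 = (w j).+1.
Proof. by rewrite /wval /= valK. Qed.

Lemma wval_ltn (n : nat) (w : 'S_n) (i : nat) (lt_in : (i < n)%N) :
  wval w i.+1 = (w (Ordinal lt_in)).+1.
Proof. by rewrite -wval_ord. Qed.

Lemma wval1_bounds (n : nat) (w : 'S_n) :
  (0 < n)%N -> (1 <= wval w 1 <= n)%N.
Proof. by move=> n_gt0; rewrite (wval_ltn _ _ _ n_gt0) /= ltn_ord. Qed.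

Lemma wval_lift_perm_first (n : nat) (k : 'I_n.+1) (s : 'S_n) :
  wval (lift_perm ord0 k s) 1 = k.+1.
Proof. by rewrite (wval_ord _ _ ord0) lift_perm_id. Qed.

Lemma wval_lift_perm (n : nat) (k : 'I_n.+1) (s : 'S_n) (j : 'I_n) :
  wval (lift_perm ord0 k s) j.+2 = (bump k (s j)).+1.
Proof. by rewrite (wval_ord _ _ (lift ord0 j)) lift_perm_lift. Qed.

(** The letters after the first are renumbered by [bump k], which is
    increasing, so their comparisons are those of [s]. *)
Lemma ltn_wval_lift_perm (n : nat) (k : 'I_n.+1) (s : 'S_n) (i j : 'I_n) :
  (wval (lift_perm ord0 k s) i.+2 < wval (lift_perm ord0 k s) j.+2)%N
    = (wval s i.+1 < wval s j.+1)%N.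
Proof. by rewrite !wval_lift_perm !wval_ord !ltnS !ltnNge leq_bump2. Qed.

Lemma initial_descent_lift_perm (n : nat) (k : 'I_n.+1) (s : 'S_n) :
  (0 < n)%N -> initial_descent (lift_perm ord0 k s) = (wval s 1 <= k)%N.
Proof.
move=> n_gt0; rewrite /initial_descent ltnS n_gt0 /=.
rewrite wval_lift_perm_first (wval_lift_perm _ _ _ (Ordinal n_gt0)).
by rewrite (wval_ltn _ _ _ n_gt0) !ltnS /bump; lia.
Qed.

Lemma no_descent3P (n : nat) (w : 'S_n) :
  reflect (forall i, ~~ descent3_at w i) (no_descent3 w).
Proof.
apply: (iffP forallP) => [noD i|noD i]; last exact: noD.
case: (ltnP i n.+1) => [lt_in|le_ni]; first exact: (noD (Ordinal lt_in)).
by apply/negP => /and4P[_ le_in _ _]; lia.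
Qed.

Lemma descent3_at_lift_perm_first (n : nat) (k : 'I_n.+1) (s : 'S_n) :
  descent3_at (lift_perm ord0 k s) 1
    = initial_descent (lift_perm ord0 k s) && initial_descent s.
Proof.
rewrite /descent3_at /initial_descent addn2 !ltnS leqnn andTb.
case: (leqP 2 n) => [n_gt1|_]; last by rewrite andFb andbF.
have n_gt0 := ltnW n_gt1.
rewrite (ltn_wval_lift_perm _ _ _ (Ordinal n_gt1) (Ordinal n_gt0)).
by rewrite n_gt0.
Qed.

Lemma descent3_at_lift_perm (n : nat) (k : 'I_n.+1) (s : 'S_n) (i : nat) :
  descent3_at (lift_perm ord0 k s) i.+2 = descent3_at s i.+1.
Proof.
rewrite /descent3_at /= addSn ltnS.
case: (leqP (i.+1 + 2) n) => //= le_in.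
have lt0 : (i < n)%N by lia.
have lt1 : (i.+1 < n)%N by lia.
have lt2 : (i.+2 < n)%N by lia.
by rewrite (ltn_wval_lift_perm _ _ _ (Ordinal lt1) (Ordinal lt0))
           (ltn_wval_lift_perm _ _ _ (Ordinal lt2) (Ordinal lt1)).
Qed.

(** Only the first window of three letters involves the prepended letter; every
    other window of [lift_perm ord0 k s] is a window of [s]. *)
Lemma no_descent3_lift_perm (n : nat) (k : 'I_n.+1) (s : 'S_n) :
  no_descent3 (lift_perm ord0 k s)
    = no_descent3 s
      && ~~ (initial_descent (lift_perm ord0 k s) && initial_descent s).
Proof.
rewrite -descent3_at_lift_perm_first.
apply/no_descent3P/andP => [noD|[/no_descent3P noDs noD1] [|[|i]]] //.
  split=> //; apply/no_descent3P => -[|i] //.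
  by rewrite -(descent3_at_lift_perm _ k).
by rewrite descent3_at_lift_perm.
Qed.

(** The first letter and the standardized rest determine a permutation; since
    [(n+1)! = (n+1) n!], injectivity suffices. *)
Lemma lift_perm_pair_bij (n : nat) :
  bijective (fun p : 'I_n.+1 * 'S_n => lift_perm ord0 p.1 p.2).
Proof.
apply: inj_card_bij => [[k s] [k' s'] /= eq_w|]; last first.
  by rewrite card_prod card_ord !card_Sn factS.
have eq_k : k = k'.
  by have := congr1 (fun w : 'S_n.+1 => w ord0) eq_w; rewrite !lift_perm_id.
congr pair; first exact: eq_k.
apply/permP => j; apply: (@lift_inj _ k).
have := congr1 (fun w : 'S_n.+1 => w (lift ord0 j)) eq_w.
by rewrite !lift_perm_lift -eq_k.
Qed.

(** * Generating functions by first letter *)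

Definition first_letter_gf (n : nat) (C : pred 'S_n) : {fps int} :=
  \sum_(w : 'S_n | C w) fpsX ^+ wval w 1.

Lemma first_letter_gf_lift (n : nat) (C : pred 'S_n.+1) :
  first_letter_gf n.+1 C
    = \sum_(s : 'S_n) \sum_(k < n.+1 | C (lift_perm ord0 k s)) fpsX ^+ k.+1.
Proof.
rewrite /first_letter_gf (reindex _ (onW_bij _ (lift_perm_pair_bij n))) /=.
rewrite -(pair_big_dep xpredT
  (fun k s => C (lift_perm ord0 k s))
  (fun k s => fpsX ^+ wval (lift_perm ord0 k s) 1)) /=.
rewrite (exchange_big_dep xpredT) //=.
apply: eq_bigr => s _; apply: eq_bigr => k _.
by rewrite wval_lift_perm_first.
Qed.

Lemma geometric_sum (R : comNzRingType) (x : R) (a b : nat) :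
  (a <= b)%N ->
  (1 - x) * \sum_(a <= k < b) x ^+ k.+1 = x ^+ a.+1 - x ^+ b.+1.
Proof.
move=> le_ab; rewrite -[RHS]opprB -(telescope_sumr (fun k => x ^+ k.+1)) //.
rewrite mulr_sumr -sumrN; apply: eq_bigr => k _.
by rewrite mulrBl mul1r -exprS opprB.
Qed.

Lemma first_letter_gf1 (C : pred 'S_1) : C 1%g -> first_letter_gf 1 C = fpsX.
Proof.
move=> C1; have only1 (w : 'S_1) : w = 1%g.
  by apply/permP => i; rewrite !ord1.
rewrite /first_letter_gf (big_pred1 1%g) => [|w].
  by rewrite (wval_ord _ _ ord0) perm1 expr1.
by rewrite (only1 w) C1 /= eqxx.
Qed.

Definition ascending (n : nat) (w : 'S_n) : bool :=
  no_descent3 w && ~~ initial_descent w.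

Definition descending (n : nat) (w : 'S_n) : bool :=
  no_descent3 w && initial_descent w.

Lemma first_letter_gf_split (n : nat) :
  first_letter_gf n (@no_descent3 n)
    = first_letter_gf n (ascending n) + first_letter_gf n (descending n).
Proof.
by rewrite /first_letter_gf (bigID (@initial_descent n)) /= addrC.
Qed.

Lemma fpsC_card (T : finType) (C : pred T) :
  fpsC (#|[set t | C t]|)%:Z = \sum_(t | C t) (1 : {fps int}).
Proof.
have -> : \sum_(t | C t) (1 : {fps int}) = (#|[set t | C t]|)%:R.
  by rewrite -sumr_const; apply: eq_bigl => t; rewrite inE.
elim: #|_| => [|k IHk]; first by apply/fpsP => -[].
by rewrite mulrS -IHk; apply/fpsP => -[|m] //=; rewrite intS.
Qed.

(** The letters that can be put in front of [s] without creating an initial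
    descent are [1 .. s(1)], so each [s] contributes
    [(1 - x)(x + ... + x^s(1)) = x (1 - x^s(1))]; no 3-descent can appear. *)
Lemma first_letter_gf_ascent (n : nat) : (0 < n)%N ->
  (1 - fpsX) * first_letter_gf n.+1 (ascending n.+1)
    = fpsX * (fpsC (f3 n)%:Z - first_letter_gf n (@no_descent3 n)).
Proof.
move=> n_gt0; rewrite first_letter_gf_lift mulr_sumr.
have -> : fpsC (f3 n)%:Z = \sum_(s : 'S_n | no_descent3 s) (1 : {fps int}).
  by rewrite fpsC_card.
rewrite mulrBr !mulr_sumr -sumrB [RHS]big_mkcond /=; apply: eq_bigr => s _.
have le_s1n : (wval s 1 <= n.+1)%N by case/andP: (wval1_bounds _ s n_gt0); lia.
case: ifPn => [noDs|Ds]; last first.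
  rewrite big_pred0 ?mulr0 // => k.
  by rewrite /ascending no_descent3_lift_perm (negbTE Ds).
rewrite (eq_bigl (fun k : 'I_n.+1 => (k < wval s 1)%N)) => [|k]; last first.
  rewrite /ascending no_descent3_lift_perm noDs.
  rewrite initial_descent_lift_perm //= -ltnNge.
  by case: leqP => _; rewrite ?andbF ?andbT.
rewrite -(big_ord_widen _ (fun k => fpsX ^+ k.+1)) //.
rewrite -(big_mkord xpredT (fun k => fpsX ^+ k.+1)) geometric_sum //.
by rewrite mulr1 expr1 exprS.
Qed.

(** The letters that create an initial descent in front of [s] are
    [s(1)+1 .. n+1], so each admissible [s] contributes
    [(1 - x)(x^(s(1)+1) + ... + x^(n+1)) = x x^s(1) - x^(n+2)]; an [s] with an
    initial descent is excluded because it would complete a 3-descent. *)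
Lemma first_letter_gf_descent (n : nat) : (0 < n)%N ->
  (1 - fpsX) * first_letter_gf n.+1 (descending n.+1)
    = fpsX * first_letter_gf n (ascending n) - fpsX ^+ n.+2 * fpsC (g3 n)%:Z.
Proof.
move=> n_gt0; rewrite first_letter_gf_lift mulr_sumr.
have -> : fpsC (g3 n)%:Z = \sum_(s : 'S_n | ascending n s) (1 : {fps int}).
  by rewrite fpsC_card.
rewrite !mulr_sumr -sumrB [RHS]big_mkcond /=; apply: eq_bigr => s _.
have le_s1n : (wval s 1 <= n.+1)%N by case/andP: (wval1_bounds _ s n_gt0); lia.
case: ifPn => [/andP[noDs noIs]|noA]; last first.
  rewrite big_pred0 ?mulr0 // => k; apply: contraNF noA.
  rewrite /descending no_descent3_lift_perm.
  case/andP=> /andP[noDs noII] Iw; rewrite Iw in noII.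
  by rewrite /ascending noDs.
rewrite (eq_bigl (fun k : 'I_n.+1 => (wval s 1 <= k)%N)) => [|k]; last first.
  rewrite /descending no_descent3_lift_perm noDs (negbTE noIs) andbF /=.
  by rewrite initial_descent_lift_perm.
rewrite -(big_geq_mkord _ _ xpredT (fun k => fpsX ^+ k.+1)).
by rewrite geometric_sum // mulr1 exprS.
Qed.

(** * The functional equations *)

Lemma coeffps_first_letter_gf (n m : nat) (C : pred 'S_n) :
  (first_letter_gf n C).[^ m] = (#|[set w | C w & wval w 1 == m]|)%:Z.
Proof.
have coeff_sum (r : seq 'S_n) :
    (\sum_(w <- r | C w) fpsX ^+ wval w 1 : {fps int}).[^ m]
      = \sum_(w <- r | C w) (m == wval w 1)%:R.
  elim: r => [|w r IHr]; first by rewrite !big_nil.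
  rewrite !big_cons; case: ifP => _ //.
  by rewrite coeffpsD IHr coeffpsXn.
rewrite coeff_sum -natz cardsE -sum1_card big_mkcondr natr_sum /=.
by apply: eq_bigr => w _; rewrite eq_sym; case: eqP.
Qed.

(** Size zero is cut off because the empty permutation has no first letter:
    there [wval w 1] takes its default value [0], which would add a term [1]. *)
Definition class_gf (C : forall n, pred 'S_n) : {fps {fps int}} :=
  \fps_n (if (0 < n)%N then first_letter_gf n (C n) else 0).

Lemma T3_class_gf : T3 = class_gf no_descent3.
Proof.
apply/fpsP => -[|n]; apply/fpsP => m /=; first by rewrite leqn0; case: m.
rewrite coeffps_first_letter_gf; case: ifPn => // out_m.
apply/esym/eqP; rewrite -[_ == _]/(_ == 0%N) cards_eq0; apply/eqP/setP => w.
rewrite !inE; apply/negbTE/nandP; right.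
by apply: contraNneq out_m => <-; exact: wval1_bounds.
Qed.

Lemma class_gf_split :
  class_gf no_descent3 = class_gf ascending + class_gf descending.
Proof.
apply/fpsP => -[|n]; first by rewrite coeffpsD /= addr0.
exact: first_letter_gf_split.
Qed.

Lemma coeffpsXM (R : comNzRingType) (f : {fps R}) (n : nat) :
  (fpsX * f).[^ n] = if n is n'.+1 then f.[^ n'] else 0.
Proof.
case: n => [|n]; first by rewrite coeffps0M mul0r.
rewrite coeffpsM 2!big_ord_recl big1 => [|i _]; last first.
  by rewrite coeffpsX mul0r.
by rewrite !coeffpsX mul0r mul1r add0r addr0 subSS subn0.
Qed.

Lemma one_sub_varx : 1 - varx = fpsC (1 - fpsX).
Proof. by apply/fpsP => -[|n]; rewrite coeffpsB /= ?subr0. Qed.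

Lemma coeffps_subst_vary (f : {fps int}) (n : nat) :
  (fps_subst f vary).[^ n] = fpsC f.[^ n].
Proof.
have -> : vary = fpsC 1 * fpsX by rewrite mul1r.
by rewrite coeff_fps_substCX expr1n mulr1.
Qed.

Lemma fpsC0 (R : comNzRingType) : fpsC 0 = 0 :> {fps R}.
Proof. by apply/fpsP => -[]. Qed.

Lemma ascending_gf_eq :
  (1 - varx) * class_gf ascending
    = vary * (varx * (1 - varx))
      + vary * (varx * (fps_subst F3 vary - class_gf no_descent3)).
Proof.
rewrite one_sub_varx; apply/fpsP => n.
rewrite coeffpsD !coeffpsXM coeffpsCM; case: n => [|[|n]].
- by rewrite mulr0 addr0.
- rewrite !coeffpsCM coeffpsB coeffps_subst_vary subr0 coeffpsC /=.
  (* Size one: the only permutation has no descent, and [F3] starts at [y]. *)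
  rewrite fpsC0 mulr0 addr0 first_letter_gf1 1?mulrC //.
  apply/andP; split=> //; apply/no_descent3P => i.
  by apply/negP => /and4P[i_gt0 le_i1 _ _]; lia.
- by rewrite /varx !coeffpsCM coeffpsB coeffps_subst_vary mulr0 add0r
             first_letter_gf_ascent.
Qed.

Lemma descending_gf_eq :
  (1 - varx) * class_gf descending
    = vary * (varx * class_gf ascending)
      - vary * (varx ^+ 2 * fps_subst G3 (varx * vary)).
Proof.
rewrite one_sub_varx; apply/fpsP => n.
rewrite coeffpsB !coeffpsXM coeffpsCM; case: n => [|[|n]].
- by rewrite mulr0 subr0.
- have -> : (class_gf descending).[^ 1] = 0.
    by apply: big_pred0 => w; rewrite /descending andbF.
  rewrite !expr2 -!mulrA /varx !coeffpsCM coeff_fps_substCX.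
  by rewrite fpsC0 mul0r !mulr0 subr0.
- rewrite !expr2 -!mulrA /varx !coeffpsCM coeff_fps_substCX.
  rewrite first_letter_gf_descent //=; congr (_ - _).
  by rewrite [fpsC _ * _]mulrC !exprS !mulrA.
Qed.

(** With [a = x y] and [b = 1 - x], the two equations give [b^2 T], hence
    [(a^2 + a b + b^2) T]; the factor [a - b] completes the difference of
    cubes [a^3 - b^3]. *)
Lemma eliminate_ascending_descending (R : comNzRingType) (x y T A D F G : R) :
  T = A + D ->
  (1 - x) * A = y * (x * (1 - x)) + y * (x * (F - T)) ->
  (1 - x) * D = y * (x * A) - y * (x ^+ 2 * G) ->
  T * (x ^+ 3 * y ^+ 3 - (1 - x) ^+ 3)
    = x * y * (x ^+ 2 * y ^+ 2 - (1 - x) ^+ 2) * F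
      + (x - 1) * x ^+ 2 * y * (x * y + x - 1) * G
      + (x - 1) * x * y * ((x - 1) ^+ 2 - x ^+ 2 * y ^+ 2).
Proof.
move=> defT eqA eqD.
have eqT : (1 - x) ^+ 2 * T
    = (1 - x + x * y) * ((1 - x) * A) - (1 - x) * (y * (x ^+ 2 * G)).
  have -> : (1 - x) ^+ 2 * T = (1 - x) * ((1 - x) * A + (1 - x) * D).
    by rewrite defT; ring.
  by rewrite eqD; ring.
have -> : T * (x ^+ 3 * y ^+ 3 - (1 - x) ^+ 3)
    = (x * y - (1 - x)) * ((x * y * (x * y + (1 - x))) * T + (1 - x) ^+ 2 * T).
  by ring.
by rewrite eqT eqA; ring.
Qed.

Theorem proposition2p14 :
  let x : {fps {fps int}} := varx in
  let y : {fps {fps int}} := vary in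
  let P := x * y * (x ^+ 2 * y ^+ 2 - (1 - x) ^+ 2) in
  let Q := (x - 1) * x ^+ 2 * y * (x * y + x - 1) in
  let R := (x - 1) * x * y * ((x - 1) ^+ 2 - x ^+ 2 * y ^+ 2) in
  T3 = (P * fps_subst F3 y + Q * fps_subst G3 (x * y) + R)
         / (x ^+ 3 * y ^+ 3 - (1 - x) ^+ 3).
Proof.
move=> x y P Q R; apply: (canRL (mulrK T3_denominator_unit)).
rewrite T3_class_gf.
exact: (eliminate_ascending_descending _ _ _ _ _ _ _ _
  class_gf_split ascending_gf_eq descending_gf_eq).
Qed.
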